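(* Let $k^a,\ell^a$ be the kernels (with parameter $o_2$) defined in the context. The error dynamics \begin{align*} e^w_t(x,t)&=e^w_{xx}(x,t)-\rho e^w(x,t)+\alpha e^v(x,t)-\eta_1(x)e^w(1,t),\\ 0&=e^v_{xx}(x,t)-\gamma e^v(x,t)+\beta e^w(x,t),\\ e^w_x(0,t)&=0,\quad e^w_x(1,t)=-\eta_2e^w(1,t),\quad e^v_x(0,t)=0,\quad e^v_x(1,t)=0 \end{align*} ($x\in[0,1]$, $t\ge0$) with output injections $\eta_1(x)=0$ and $\eta_2=-k^a(1,1)=\frac12o_2$ are exponentially stable if $o_2$ satisfies $$o_2+\rho>\frac{|\alpha||\beta|}{\gamma}(1+\|k^a\|)(1+\|\ell^a\|)+\frac{(1+\|\ell^a\|)^2\|k^a_x(1,\cdot)\|^2+2}{2}.$$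
   Context: The parameters $\rho,\alpha,\beta,\gamma$ are real with $\alpha,\beta$ nonzero, $\gamma\neq-(n\pi)^2$ for $n=0,1,2,\dots$, and $o_2>0$. The errors are $e^w=w-\hat w$, $e^v=v-\hat v$ (superscripts are labels), where $(w,v)$ solves the plant $w_t=w_{xx}-\rho w+\alpha v$, $0=v_{xx}-\gamma v+\beta w$, $w_x(0,t)=0$, $w_x(1,t)=u(t)$, $v_x(0,t)=v_x(1,t)=0$ with control input $u(t)$, and $(\hat w,\hat v)$ is the observer using only the measurement $w(1,t)$: $\hat w_t=\hat w_{xx}-\rho\hat w+\alpha\hat v+\eta_1(x)[w(1,t)-\hat w(1,t)]$, $0=\hat v_{xx}-\gamma\hat v+\beta\hat w$, $\hat w_x(0,t)=0$, $\hat w_x(1,t)=u(t)+\eta_2[w(1,t)-\hat w(1,t)]$, $\hat v_x(0,t)=\hat v_x(1,t)=0$. For $0\le y\le x\le1$ (values at $y=x$ by continuity), $k^a(x,y)=-o_2x\frac{I_1(\sqrt{o_2(x^2-y^2)})}{\sqrt{o_2(x^2-y^2)}}$, which is the solution of $k^a_{yy}-k^a_{xx}+o_2k^a=0$ for $0<y<x<1$, $k^a_y(x,0)=0$, $k^a(x,x)=-\frac12o_2x$; and $\ell^a(x,y)=-o_2x\frac{J_1(\sqrt{o_2(x^2-y^2)})}{\sqrt{o_2(x^2-y^2)}}$. Here $I_1(x)=\sum_{m\ge0}\frac{(x/2)^{2m+1}}{m!(m+1)!}$, $J_1(x)=\sum_{m\ge0}(-1)^m\frac{(x/2)^{2m+1}}{m!(m+1)!}$.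 For kernels, $\|k\|=\left(\int_0^1\int_0^x|k(x,y)|^2\,dy\,dx\right)^{1/2}$, while $\|k^a_x(1,\cdot)\|=\left(\int_0^1|k^a_x(1,y)|^2dy\right)^{1/2}$. The state is $e^w(\cdot,t)\in L^2(0,1)$, with $e^v(\cdot,t)$ determined by the elliptic equation. Exponentially stable means there are $M\ge1$, $\omega>0$ with $\|e^w(\cdot,t)\|+\|e^v(\cdot,t)\|\le Me^{-\omega t}\|e^w(\cdot,0)\|$ ($L^2(0,1)$ norms) for all $t\ge0$ and all initial data in $L^2(0,1)$.
   Formalization: The formal theorem assumes γ > 0; for γ < 0 the claim fails, e.g. γ = −1, α = 1, β = −B with B large satisfies the condition, yet the error dynamics have a growing mode. *)

(* Defs.v *)
From HB Require Import structures.
From mathcomp Require Import all_boot all_order all_algebra.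
From mathcomp Require Import all_classical all_reals all_analysis.

Set Implicit Arguments.
Unset Strict Implicit.
Unset Printing Implicit Defensive.

Import Order.TTheory GRing.Theory Num.Theory.
Import numFieldNormedType.Exports.

Local Open Scope classical_set_scope.
Local Open Scope ring_scope.

Section BesselKernels.
Context {R : realType}.
Implicit Types (o x y z : R).

Definition besselI1 z : R :=
  limn (series (fun m : nat =>
    (z / 2) ^+ m.*2.+1 / ((m`!)%:R * (m.+1`!)%:R))).

Definition besselJ1 z : R :=
  limn (series (fun m : nat =>
    (-1) ^+ m * (z / 2) ^+ m.*2.+1 / ((m`!)%:R * (m.+1`!)%:R))).

(* B z / z with its removable singularity at 0 filled in: both I_1(z) / z and
   J_1(z) / z tend to 1/2. *)
Definition bessel_quotient (B : R -> R) z : R :=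
  if z == 0 then 2^-1 else B z / z.

(* The kernels live on 0 <= y <= x <= 1; outside that triangle the values are
   irrelevant (Num.sqrt is 0 on negative numbers). *)
Definition ka o x y : R :=
  - o * x * bessel_quotient besselI1 (Num.sqrt (o * (x ^+ 2 - y ^+ 2))).

Definition la o x y : R :=
  - o * x * bessel_quotient besselJ1 (Num.sqrt (o * (x ^+ 2 - y ^+ 2))).

(* k_x(1, y).  For y < 1 the formula for the kernel makes sense and is smooth
   on a neighbourhood of x = 1, so the two-sided derivative is the derivative
   from inside the triangle.  The single point y = 1 is negligible. *)
Definition dx_at1 (k : R -> R -> R) (y : R) : R := derive1 (fun x => k x y) 1.

Definition triangle_norm (k : R -> R -> R) : R :=
  Num.sqrt (\int[lebesgue_measure]_(x in `[0, 1])
              (\int[lebesgue_measure]_(y in `[0, x]) (k x y ^+ 2))).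

End BesselKernels.

Section FunctionSpaces.
Context {R : realType}.
Local Notation mu := (@lebesgue_measure R).

Definition L2 (f : R -> R) : Prop := (f \_ `[0, 1]) \in Lfun mu 2%:E.

(* fine is harmless for f satisfying L2. *)
Definition L2norm (f : R -> R) : R := fine 'N[mu]_2%:E[EFin \o (f \_ `[0, 1])].

Definition primitive_on01 (f f' : R -> R) : Prop :=
  forall x : R, 0 <= x <= 1 -> f x = f 0 + \int[mu]_(y in `[0, x]) f' y.

(* f is the continuously differentiable representative of an element of
   H^2(0,1), with first derivative f' and weak second derivative f''. *)
Definition H2 (f f' f'' : R -> R) : Prop :=
  [/\ L2 f'', primitive_on01 f' f'' & primitive_on01 f f'].

End FunctionSpaces.

Section ErrorDynamics.
Context {R : realType}.
Local Notation mu := (@lebesgue_measure R).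
Variables (rho alpha beta gamma : R) (eta1 : R -> R) (eta2 : R).

(* Functions are written time first: w t x is e^w(x,t) and v t x is e^v(x,t).
   The initial datum w 0 is an arbitrary element of L^2(0,1).  This is the
   classical solution of the abstract Cauchy problem in the state space
   L^2(0,1): continuous in L^2 at t = 0, differentiable in L^2 for t > 0 with
   values in H^2(0,1), the equations holding for almost every x.  The elliptic
   equation is required at t = 0 too, so that v 0 is determined by w 0. *)
Record error_solution (w wt wx wxx v vx vxx : R -> R -> R) : Prop := {
  state_L2 : forall t : R, 0 <= t -> L2 (w t) ;
  state_cvg0 : L2norm (fun x => w t x - w 0 x) @[t --> 0^'+] --> (0 : R) ;
  deriv_L2 : forall t : R, 0 < t -> L2 (wt t) ;
  state_deriv : forall t : R, 0 < t ->
    L2norm (fun x => (w (t + h) x - w t x) / h - wt t x) @[h --> 0^'] -->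
    (0 : R) ;
  state_H2 : forall t : R, 0 < t -> H2 (w t) (wx t) (wxx t) ;
  parabolic_eq : forall t : R, 0 < t -> {ae mu, forall x : R, 0 <= x <= 1 ->
    wt t x = wxx t x - rho * w t x + alpha * v t x - eta1 x * w t 1} ;
  state_bc0 : forall t : R, 0 < t -> wx t 0 = 0 ;
  state_bc1 : forall t : R, 0 < t -> wx t 1 = - eta2 * w t 1 ;
  elliptic_H2 : forall t : R, 0 <= t -> H2 (v t) (vx t) (vxx t) ;
  elliptic_eq : forall t : R, 0 <= t -> {ae mu, forall x : R, 0 <= x <= 1 ->
    0 = vxx t x - gamma * v t x + beta * w t x} ;
  elliptic_bc0 : forall t : R, 0 <= t -> vx t 0 = 0 ;
  elliptic_bc1 : forall t : R, 0 <= t -> vx t 1 = 0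
}.

Definition exponentially_stable : Prop :=
  exists M omega : R, [/\ 1 <= M, 0 < omega &
    forall w wt wx wxx v vx vxx, error_solution w wt wx wxx v vx vxx ->
    forall t : R, 0 <= t ->
      L2norm (w t) + L2norm (v t) <= M * expR (- omega * t) * L2norm (w 0)].

End ErrorDynamics.

(* Main.v *)
Require Import Defs.
From HB Require Import structures.
From mathcomp Require Import all_boot all_order all_algebra.
From mathcomp Require Import all_classical all_reals all_analysis.
From mathcomp Require Import measurable_realfun ring lra.

Set Implicit Arguments.
Unset Strict Implicit.
Unset Printing Implicit Defensive.

Import Order.TTheory GRing.Theory Num.Theory.
Import numFieldNormedType.Exports.

Local Open Scope classical_set_scope.
Local Open Scope ring_scope.

(** Write K for the L^2 norm of k^a_x(1, .).  The smallness condition is so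
strong that it makes the uncoupled decay rate beat the coupling:
[rho > |alpha| |beta| / gamma].  The plain energy [||e^w||^2] of the error
system, in its original variables, is then a Lyapunov function.

Why the condition forces this.  Its factors [1 + ||k^a||] and [1 + ||l^a||] are
at least 1, so it implies [o2 + rho > |alpha| |beta| / gamma + K^2 / 2 + 1].
On the other hand [k^a(x, y) = - o2 x f(o2 (x^2 - y^2))], where
[f(s) = I_1(sqrt s) / sqrt s] is a power series with nonnegative coefficients
1/2, 1/16, ...; differentiating in x at x = 1 gives
[|k^a_x(1, y)| = o2 (f + 2 o2 f') >= o2 / 2 + o2^2 / 8] ([L2norm_dx_at1_ka]).
This lower bound is large enough for [K^2 / 2 + 1 >= o2] whatever the value of
o2 ([sqr_dominates]), so o2 cancels from the condition.

Why the energy decays ([energy_stability]).  Testing the elliptic equation with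
e^v gives [gamma ||e^v||^2 <= beta <e^w, e^v>], hence
[||e^v|| <= (|beta| / gamma) ||e^w||] ([elliptic_bound]).  Testing the
parabolic equation with e^w, where the boundary terms contribute
[- eta_2 e^w(1)^2 <= 0], gives
[d/dt ||e^w||^2 <= - 2 (rho - |alpha| |beta| / gamma) ||e^w||^2]
([dissipation]), and Gronwall's inequality concludes.  Both tests rest on
Green's identity for an H^2 function ([green_identity]), obtained from Fubini's
theorem because the second derivative is only square integrable. *)

(** * The inner product of L^2(0, 1) *)

Section L2space.
Context {R : realType}.
Local Notation mu := (@lebesgue_measure R).
Implicit Types (f g F : R -> R) (c : R).

Definition dotp f g : R := \int[mu]_(x in `[0, 1]) (f x * g x).

Lemma sqr_patch f : (fun x : R => `|((f \_ `[0, 1]) x)%:E| `^ 2)%E =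
                  (fun x : R => (((fun x => f x * f x) \_ `[0, 1]) x)%:E).
Proof.
apply/funext => x /=; rewrite powR_mulrn// -normrX ger0_norm ?sqr_ge0//.
by rewrite /patch; case: ifPn => // _; rewrite expr0n.
Qed.

Lemma L2norm_sqr f : L2norm f ^+ 2 = dotp f f.
Proof.
rewrite /L2norm unlock /dotp Rintegral_mkcond /Rintegral sqr_patch fine_poweR.
have I0 : 0 <= fine (\int[mu]_x (((fun x => f x * f x) \_ `[0, 1]) x)%:E)%E.
  apply: Rintegral_ge0 => x _; rewrite /patch.
  by case: ifPn => // _; rewrite -expr2 sqr_ge0.
by rewrite powR12_sqrt// sqr_sqrtr.
Qed.

Lemma L2norm_ge0 f : 0 <= L2norm f.
Proof. by rewrite /L2norm fine_ge0// Lnorm_ge0. Qed.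

Lemma L2P f : L2 f <->
  measurable_fun (`[0, 1] : set R) f /\
  mu.-integrable `[0, 1] (EFin \o (fun x => f x * f x)).
Proof.
split=> [L|[mf If]].
- split.
    move: L => /andP[]; rewrite !inE => mf _.
    by apply/(measurable_restrictT _ (measurable_itv _)).
  move/Lfun2_integrable_sqr: L => H.
  apply/integrable_mkcond => //.
  apply: eq_integrable H => // x _ /=.
  by rewrite /patch; case: ifPn => // _; rewrite expr0n.
- apply/andP; split; rewrite inE/=.
    by apply/(measurable_restrictT _ (measurable_itv _)).
  rewrite /finite_norm unlock.
  apply: poweR_lty.
  rewrite sqr_patch.
  move/integrable_mkcond: If => /(_ (measurable_itv _)) /integrableP[_].
  apply: le_lt_trans; rewrite le_eqVlt; apply/orP; left; apply/eqP.
  apply: eq_integral => x _; rewrite /= /patch; case: ifPn => _ /=.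
    by rewrite ger0_norm// -expr2 sqr_ge0.
  by rewrite normr0.
Qed.

Lemma L2_integrableM f g : L2 f -> L2 g ->
  mu.-integrable `[0, 1] (EFin \o (fun x => f x * g x)).
Proof.
move=> Lf Lg; apply/integrable_mkcond => //.
have /Lfun1_integrable H := Lfun2_mul_Lfun1 Lf Lg.
apply: eq_integrable H => // x _ /=.
by rewrite /patch; case: ifPn => // _; rewrite mulr0.
Qed.

Lemma L2D f g : L2 f -> L2 g -> L2 (fun x => f x + g x).
Proof.
move=> Lf Lg; rewrite /L2.
have -> : (fun x => f x + g x) \_ `[0, 1] = f \_ `[0, 1] + g \_ `[0, 1].
  by apply/funext => x; rewrite fctE /patch; case: ifPn; rewrite ?addr0.
by apply: (proj2 (Lfun_addr_closed mu _)) => //; rewrite lee_fin ler1n.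
Qed.

Lemma L2Z c f : L2 f -> L2 (fun x => c * f x).
Proof.
move=> Lf; rewrite /L2.
have -> : (fun x => c * f x) \_ `[0, 1] = c \o* (f \_ `[0, 1]).
  apply/funext => x; rewrite /= /patch; case: ifPn => _; last by rewrite mul0r.
  by rewrite mulrC.
by apply: Lfun_scale => //; rewrite ler1n.
Qed.

Lemma L2N f : L2 f -> L2 (fun x => - f x).
Proof.
by move=> /(L2Z (-1)); congr L2; apply/funext => x; rewrite mulN1r.
Qed.

Lemma L2B f g : L2 f -> L2 g -> L2 (fun x => f x - g x).
Proof. by move=> Lf Lg; apply: L2D => //; exact: L2N. Qed.

Lemma continuous_L2 f : {within `[0, 1], continuous f} -> L2 f.
Proof.
move=> cf; apply/L2P; split.
  exact: subspace_continuous_measurable_fun.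
apply: continuous_compact_integrable; first exact: segment_compact.
by move=> x; apply: continuousM; apply: cf.
Qed.

Lemma L2_integrable f : L2 f -> mu.-integrable `[0, 1] (EFin \o f).
Proof.
move=> Lf; have L1 : L2 (fun=> 1 : R).
  by apply: continuous_L2; apply: continuous_subspaceT => x; exact: cvg_cst.
have := L2_integrableM Lf L1.
by congr integrable; apply/funext => x /=; rewrite mulr1.
Qed.

Lemma dotpC f g : dotp f g = dotp g f.
Proof. by apply: eq_Rintegral => x _; rewrite mulrC. Qed.

Lemma dotpDl f g F : L2 f -> L2 g -> L2 F ->
  dotp (fun x => f x + g x) F = dotp f F + dotp g F.
Proof.
move=> Lf Lg LF; rewrite -RintegralD//; try exact: L2_integrableM.
by apply: eq_Rintegral => x _; rewrite mulrDl.
Qed.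

Lemma dotpZl c f F : L2 f -> L2 F ->
  dotp (fun x => c * f x) F = c * dotp f F.
Proof.
move=> Lf LF; rewrite -RintegralZl//; try exact: L2_integrableM.
by apply: eq_Rintegral => x _; rewrite mulrA.
Qed.

Lemma dotp_ge0 f : 0 <= dotp f f.
Proof. by apply: Rintegral_ge0 => x _; rewrite -expr2 sqr_ge0. Qed.

Lemma dotp_addZ c f g : L2 f -> L2 g ->
  dotp (fun x => f x + c * g x) (fun x => f x + c * g x) =
  dotp f f + 2 * c * dotp f g + c ^+ 2 * dotp g g.
Proof.
move=> Lf Lg; have Lcg : L2 (fun x => c * g x) by exact: L2Z.
have Lfcg : L2 (fun x => f x + c * g x) by exact: L2D.
have crossE h : L2 h -> dotp h (fun x => f x + c * g x) = dotp h f + c * dotp h g.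
  by move=> Lh; rewrite dotpC dotpDl// dotpZl// [dotp f h]dotpC [dotp g h]dotpC.
rewrite dotpDl// dotpZl// !crossE// [dotp g f]dotpC; ring.
Qed.

Lemma eq_dotpl f g F : L2 f -> L2 g -> L2 F ->
  {ae mu, forall x : R, 0 <= x <= 1 -> f x = g x} -> dotp f F = dotp g F.
Proof.
move=> Lf Lg LF fg; rewrite /dotp /Rintegral; congr fine.
apply: ae_eq_integral => //.
- by have /integrableP[] := L2_integrableM Lf LF.
- by have /integrableP[] := L2_integrableM Lg LF.
- have aeF := @ae_filter_ringOfSetsType _ _ _ mu.
  apply: filterS fg => x fg /=; rewrite in_itv/= => /fg ->//.
Qed.

Lemma dotp_cauchy_schwarz f g : L2 f -> L2 g ->
  `|dotp f g| <= L2norm f * L2norm g.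
Proof.
move=> Lf Lg.
have q s : 0 <= dotp f f + 2 * s * dotp f g + s ^+ 2 * dotp g g.
  by rewrite -dotp_addZ//; exact: dotp_ge0.
(* The quadratic [q] is nonnegative; its minimum, at [s = - b / c], is
   [a - b ^+ 2 / c]. *)
rewrite -(@ler_pXn2r _ 2)// ?nnegrE ?mulr_ge0 ?L2norm_ge0//.
rewrite exprMn !L2norm_sqr real_normK ?num_real//.
set a := dotp f f in q *; set b := dotp f g in q *; set c := dotp g g in q *.
have c0 : 0 <= c by exact: dotp_ge0.
have [c00|cn0] := eqVneq c 0.
  (* With no quadratic term, a nonzero slope would make [q] negative. *)
  have b0 : b = 0.
    apply/eqP/negPn/negP => bn0.
    have := q (- (a + 1) / (2 * b)); rewrite c00 mulr0 addr0.
    have -> : 2 * (- (a + 1) / (2 * b)) * b = - (a + 1) by field.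
    lra.
  by rewrite b0 c00 mulr0 expr0n.
have cp : 0 < c by rewrite lt_def cn0.
have := q (- b / c).
have -> : a + 2 * (- b / c) * b + (- b / c) ^+ 2 * c = a - b ^+ 2 / c by field.
by rewrite subr_ge0 ler_pdivrMr.
Qed.

End L2space.

(** * Green's identity in H^2(0, 1) *)

Section IntegrationByParts.
Context {R : realType}.
Local Notation mu := (@lebesgue_measure R).
Implicit Types (f g F G : R -> R).

Lemma primitive_continuous F f : mu.-integrable `[0, 1] (EFin \o f) ->
  primitive_on01 F f -> {within `[0, 1], continuous F}.
Proof.
move=> intf PF.
have := parameterized_integral_continuous ler01 intf.
rewrite /parameterized_integral => cf.
pose H : R -> R := fun x => F 0 + \int[mu]_(y in `[0, x]) f y.
apply: (@subspace_eq_continuous R `[0, 1] R (from_subspace `[0, 1] H)).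
  by move=> x; rewrite inE/= in_itv/= => x01; rewrite [RHS]PF.
move=> x; apply: cvgD; first exact: cvg_cst.
exact: cf.
Qed.

Lemma H2_L2 f f' f'' : H2 f f' f'' -> L2 f' /\ L2 f.
Proof.
case=> L2f'' Pf' Pf.
have Lf' : L2 f'.
  by apply: continuous_L2; apply: primitive_continuous Pf'; exact: L2_integrable.
split => //.
by apply: continuous_L2; apply: primitive_continuous Pf; exact: L2_integrable.
Qed.

Lemma EFin_Rintegral D f : measurable D -> mu.-integrable D (EFin \o f) ->
  (\int[mu]_(x in D) (f x)%:E)%E = (\int[mu]_(x in D) f x)%:E.
Proof. by move=> mD intf; rewrite /Rintegral fineK// integrable_fin_num. Qed.

Lemma tail_itv f (a : R) : 0 <= a <= 1 -> mu.-integrable `[0, 1] (EFin \o f) ->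
  \int[mu]_(x in `[a, 1]) f x =
  \int[mu]_(x in `[0, 1]) f x - \int[mu]_(x in `[0, a]) f x.
Proof.
move=> /andP[a0 a1] intf.
rewrite Rintegral_itvB ?bnd_simp// Rintegral_itv_obnd_cbnd//.
by apply: integrableS intf => //; apply: subset_itv; rewrite bnd_simp.
Qed.

(** Both sides are the integral of [f x * g y] over the triangle
[0 <= y <= x <= 1], sliced in the two directions.  Fubini's theorem allows [f]
and [g] to be merely integrable, whereas the product rule would ask for
differentiable primitives. *)
Lemma triangle_by_parts F f G g :
  mu.-integrable `[0, 1] (EFin \o f) -> mu.-integrable `[0, 1] (EFin \o g) ->
  primitive_on01 F f -> primitive_on01 G g ->
  \int[mu]_(x in `[0, 1]) (f x * (G x - G 0)) =
  \int[mu]_(y in `[0, 1]) (g y * (F 1 - F y)).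
Proof.
move=> intf intg PF PG.
(* [f] and [g] are cut off to the whole line, where product measures live. *)
have intf' : mu.-integrable setT (EFin \o (f \_ `[0, 1])).
  have /integrable_mkcond H := intf.
  by rewrite -restrict_EFin; apply: H; exact: measurable_itv.
have intg' : mu.-integrable setT (EFin \o (g \_ `[0, 1])).
  have /integrable_mkcond H := intg.
  by rewrite -restrict_EFin; apply: H; exact: measurable_itv.
have mf : measurable_fun setT (f \_ `[0, 1]).
  apply/(measurable_restrictT _ (measurable_itv _)).
  by have /integrableP[/measurable_EFinP] := intf.
have mg : measurable_fun setT (g \_ `[0, 1]).
  apply/(measurable_restrictT _ (measurable_itv _)).
  by have /integrableP[/measurable_EFinP] := intg.
pose psi (z : R * R) := ((f \_ `[0, 1]) z.1 * (g \_ `[0, 1]) z.2)%:E.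
pose phi (z : R * R) := if z.2 <= z.1 then psi z else 0%E.
have mpsi : measurable_fun setT psi.
  apply/measurable_EFinP; apply: measurable_funM.
    exact: measurableT_comp mf measurable_fst.
  exact: measurableT_comp mg measurable_snd.
have mphi : measurable_fun setT phi.
  apply: measurable_fun_ifT => //.
  by apply: measurable_fun_ler; [exact: measurable_snd|exact: measurable_fst].
have ipsi : (mu \x mu)%E.-integrable setT psi.
  apply/integrable12ltyP => //.
  have /integrableP[_ If] := intf'.
  have /integrableP[_ Ig] := intg'.
  under eq_integral => x _.
    under eq_integral => y _ do rewrite /psi/= normrM EFinM.
    rewrite ge0_integralZl//; last first.
      by apply/measurable_EFinP; apply: measurableT_comp.
    over.
  rewrite /= ge0_integralZr//; last 2 first.
  - by apply/measurable_EFinP; apply: measurableT_comp.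
  - exact: integral_ge0.
  apply: lte_mul_pinfty => //; first exact: integral_ge0.
  by rewrite ge0_fin_numE//; exact: integral_ge0.
have iphi : (mu \x mu)%E.-integrable setT phi.
  apply: le_integrable ipsi => // z _; rewrite /phi.
  by case: ifP => // _; rewrite abse0.
have patchE (h : R -> R) (x : R) : (h \_ `[0, 1]) x = if 0 <= x <= 1 then h x else 0 :> R.
  by rewrite /patch mem_setE in_itv.
have inner_y x : (\int[mu]_y phi (x, y))%E =
    (((fun x => f x * (G x - G 0)) \_ `[0, 1]) x)%:E.
  rewrite patchE; case: ifPn => [x01|x01]; last first.
    by apply: integral0_eq => y _; rewrite /phi/psi/= patchE (negbTE x01) mul0r if_same.
  have /andP[x0 x1] := x01.
  have ig : mu.-integrable `[0, x] (EFin \o g).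
    by apply: integrableS intg => //; apply: subset_itv; rewrite bnd_simp.
  rewrite PG// addrC addKr -RintegralZl// -EFin_Rintegral//; last first.
    by apply: (integrableZl _ (f x) ig); exact: measurable_itv.
  rewrite [RHS]integral_mkcond; apply: eq_integral => y _.
  rewrite /phi/psi/= !patchE x01 [in RHS]/patch mem_setE in_itv/=.
  case: (leP y x) => yx; rewrite ?andbF// andbT (le_trans yx x1) andbT.
  by case: ifP => //; rewrite mulr0.
have inner_x y : (\int[mu]_x phi (x, y))%E =
    (((fun y => g y * (F 1 - F y)) \_ `[0, 1]) y)%:E.
  rewrite patchE; case: ifPn => [y01|y01]; last first.
    by apply: integral0_eq => x _; rewrite /phi/psi/= [X in _ * X]patchE (negbTE y01) mulr0 if_same.
  have /andP[y0 y1] := y01.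
  have if' : mu.-integrable `[y, 1] (EFin \o f).
    by apply: integrableS intf => //; apply: subset_itv; rewrite bnd_simp.
  rewrite PF ?lexx ?ler01// (PF y)// opprD addrACA subrr add0r -tail_itv//.
  rewrite -RintegralZl// -EFin_Rintegral//; last first.
    by apply: (integrableZl _ (g y) if'); exact: measurable_itv.
  rewrite [RHS]integral_mkcond; apply: eq_integral => x _.
  rewrite /phi/psi/= !patchE y01 [in RHS]/patch mem_setE in_itv/=.
  case: (leP y x) => yx //; rewrite (le_trans y0 yx)/= mulrC.
  by case: ifP => //; rewrite mulr0.
have := Fubini iphi.
under eq_integral do rewrite inner_y.
under [X in _ = X -> _]eq_integral do rewrite inner_x.
by move=> H; rewrite [LHS]Rintegral_mkcond [RHS]Rintegral_mkcond /Rintegral H.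
Qed.

(** Integration by parts of [f''] against [f]; it turns a second derivative
tested with the function itself into a boundary term and a sign. *)
Lemma green_identity f f' f'' : H2 f f' f'' ->
  dotp f'' f = f' 1 * f 1 - f' 0 * f 0 - dotp f' f'.
Proof.
move=> fH2; have [Lf'' Pf' Pf] := fH2; have [Lf' Lf] := H2_L2 fH2.
have c1 (c : R) : L2 (fun=> c).
  by apply: continuous_L2; apply: continuous_subspaceT => x; exact: cvg_cst.
have := triangle_by_parts (L2_integrable Lf'') (L2_integrable Lf') Pf' Pf.
have E c g h : L2 g -> L2 h -> dotp g (fun x => c - h x) =
    c * \int[mu]_(x in `[0, 1]) g x - dotp g h.
  move=> Lg Lh; rewrite dotpC.
  have -> : (fun x => c - h x) = (fun x => c + (-1) * h x).
    by apply/funext => x; rewrite mulN1r.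
  rewrite dotpDl//; last exact: L2Z.
  rewrite dotpZl// mulN1r [dotp h g]dotpC; congr (_ - _).
  by rewrite /dotp RintegralZl//; exact: L2_integrable.
have -> : \int[mu]_(x in `[0, 1]) (f'' x * (f x - f 0)) =
    - 1 * dotp f'' (fun x => f 0 - f x).
  rewrite dotpC -dotpZl//; last exact: L2B.
  by apply: eq_Rintegral => x _; ring.
rewrite -/(dotp f' _) !E//.
have := Pf 1; have := Pf' 1; rewrite lexx ler01 => /(_ isT) -> /(_ isT) ->.
move: (Rintegral _ _ _) (Rintegral _ _ _) => a b; lra.
Qed.

End IntegrationByParts.

(** * Decay of the energy in time *)

Section EnergyDecay.
Context {R : realType}.

(** [expR (c * t) * E t] is nonincreasing.  Continuity is asked at 0 only from
the right, which is all that an initial datum in L^2 provides. *)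
Lemma gronwall_decay (E dE : R -> R) (c : R) :
  (forall t : R, 0 < t -> is_derive t 1 E (dE t)) ->
  (forall t : R, 0 < t -> dE t <= - c * E t) ->
  E t @[t --> 0^'+] --> E 0 ->
  forall t : R, 0 <= t -> E t <= expR (- c * t) * E 0.
Proof.
move=> derE leE cvgE t t0.
pose f (s : R) := expR (c * s) * E s.
have df (s : R) : 0 < s -> is_derive s 1 f (expR (c * s) * (dE s + c * E s)).
  move=> s0; have := derE _ s0 => dEs.
  apply: is_derive_eq.
  by rewrite /GRing.scale/= !mulr1; ring.
have : f t <= f 0.
  apply: (@ler0_derive1_nincry _ f 0) => //.
  - by move=> s; rewrite in_itv/= andbT => /df [].
  - move=> s; rewrite in_itv/= andbT => s0; have [_ ds] := df _ s0.
    rewrite derive1E ds pmulr_rle0 ?expR_gt0//.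
    by have := leE _ s0; lra.
  apply: derivable_oy_Rcontinuous_within_itvcy; split.
    by move=> s; rewrite in_itv/= andbT => /df [].
  apply: cvgM => //; apply: cvg_at_right_filter.
  apply: continuous_comp; last exact: continuous_expR.
  by apply: cvgM; [exact: cvg_cst|exact: cvg_id].
rewrite /f mulr0 expR0 mul1r mulNr expRN mulrC -ler_pdivlMr ?expR_gt0//.
by rewrite mulrC.
Qed.

Lemma cvg_dotp0 (T : Type) (F : set_system T) {FF : Filter F}
    (q : T -> R -> R) (g : R -> R) :
  L2 g -> (\forall h \near F, L2 (q h)) ->
  L2norm (q h) @[h --> F] --> (0 : R) -> dotp (q h) g @[h --> F] --> (0 : R).
Proof.
move=> Lg Lq cq; apply/norm_cvg0P.
apply: (@squeeze_cvgr _ _ _ _ (fun=> 0) (fun h => L2norm (q h) * L2norm g)).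
- by near=> h; rewrite normr_ge0/=; apply: dotp_cauchy_schwarz => //; near: h.
- exact: cvg_cst.
- by rewrite -[X in _ --> X](mul0r (L2norm g)); apply: cvgM => //; exact: cvg_cst.
Unshelve. all: by end_near. Qed.

(** With [q h] the error of the difference quotient, [w (t + h)] is
[w t + h * (q h + wt)]; expanding the square leaves terms that vanish with
[q h] in L^2 or with [h]. *)
Lemma dotp_is_derive (w : R -> R -> R) (wt : R -> R) (t : R) :
  (\forall h \near (0 : R)^', L2 (w (t + h))) -> L2 (w t) -> L2 wt ->
  L2norm (fun x => (w (t + h) x - w t x) / h - wt x) @[h --> 0^'] --> (0 : R) ->
  is_derive t 1 (fun s => dotp (w s) (w s)) (2 * dotp wt (w t)).
Proof.
move=> Lwh Lw Lwt; pose q (h x : R) := (w (t + h) x - w t x) / h - wt x.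
rewrite -[X in X @ _ --> _]/(fun h => L2norm (q h)) => cq.
have Lq : \forall h \near 0^', L2 (q h).
  near=> h; apply: L2B => //.
  have -> : (fun x => (w (t + h) x - w t x) / h) =
      (fun x => h^-1 * (w (t + h) x - w t x)).
    by apply/funext => x; rewrite mulrC.
  by apply: L2Z; apply: L2B => //; near: h.
have qE (h : R) : h != 0 -> L2 (q h) ->
    h^-1 * (dotp (w (h + t)) (w (h + t)) - dotp (w t) (w t)) =
    2 * dotp wt (w t) + 2 * dotp (q h) (w t) +
    h * (L2norm (q h) ^+ 2 + 2 * dotp (q h) wt + dotp wt wt).
  move=> h0 Lqh; rewrite L2norm_sqr.
  have -> : w (h + t) = fun x => w t x + h * (q h x + 1 * wt x).
    by apply/funext => x; rewrite /q addrC; field.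
  have LS : L2 (fun x => q h x + 1 * wt x) by apply: L2D => //; exact: L2Z.
  rewrite dotp_addZ// dotp_addZ// dotpC dotpDl//; last exact: L2Z.
  by rewrite dotpZl//; field.
have cvgq : h^-1 *: (dotp (w (h + t)) (w (h + t)) - dotp (w t) (w t))
    @[h --> (0:R)^'] --> 2 * dotp wt (w t).
  have H : (2 * dotp wt (w t) + 2 * dotp (q h) (w t) +
      h * (L2norm (q h) ^+ 2 + 2 * dotp (q h) wt + dotp wt wt)) @[h --> (0:R)^']
      --> 2 * dotp wt (w t) + 2 * 0 + 0 * (0 ^+ 2 + 2 * 0 + dotp wt wt).
    have cw := cvg_dotp0 Lw Lq cq.
    have cwt := cvg_dotp0 Lwt Lq cq.
    apply: cvgD.
      by apply: cvgD; [exact: cvg_cst|apply: cvgM; [exact: cvg_cst|exact: cw]].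
    apply: cvgM.
      exact: (@cvg_within _ (nbhs (0:R))).
    apply: cvgD; last exact: cvg_cst.
    apply: cvgD; last by apply: cvgM; [exact: cvg_cst|exact: cwt].
    by rewrite expr2; under eq_fun do rewrite expr2; apply: cvgM.
  rewrite mulr0 addr0 mul0r addr0 in H.
  apply: cvg_trans H; apply: near_eq_cvg.
  near=> h; apply/esym/qE; first by near: h; exact: nbhs_dnbhs_neq.
  by near: h.
pose E (s : R) := dotp (w s) (w s).
have quotE : (fun h : R => h^-1 *: ((E \o shift t) (h *: 1) - E t)) =
    fun h => h^-1 *: (E (h + t) - E t).
  by apply/funext => h /=; rewrite [_%:A]mulr1.
split; first by apply/cvg_ex; exists (2 * dotp wt (w t)); rewrite quotE.
by apply: cvg_lim => //; rewrite quotE.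
Unshelve. all: by end_near. Qed.

Lemma cvg_energy0 (w : R -> R -> R) : (forall t : R, 0 <= t -> L2 (w t)) ->
  L2norm (fun x => w t x - w 0 x) @[t --> 0^'+] --> (0 : R) ->
  dotp (w t) (w t) @[t --> 0^'+] --> dotp (w 0) (w 0).
Proof.
move=> Lw cq; pose q (t x : R) := w t x - w 0 x.
have Lw0 : L2 (w 0) by exact: Lw.
have Lq : \forall t \near 0^'+, L2 (q t).
  near=> t; apply: L2B => //; apply: Lw; near: t; exact: nbhs_right_ge.
have cw := cvg_dotp0 Lw0 Lq cq.
have H : (L2norm (q t) ^+ 2 + 2 * dotp (q t) (w 0) + dotp (w 0) (w 0)) @[t --> 0^'+]
    --> 0 ^+ 2 + 2 * 0 + dotp (w 0) (w 0).
  apply: cvgD; last exact: cvg_cst.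
  apply: cvgD; last by apply: cvgM; [exact: cvg_cst|exact: cw].
  by rewrite expr2; under eq_fun do rewrite expr2; apply: cvgM.
rewrite expr0n/= mulr0 !add0r in H.
apply: cvg_trans H; apply: near_eq_cvg; near=> t.
have Lqt : L2 (q t) by near: t.
have -> : w t = fun x => q t x + 1 * w 0 x.
  by apply/funext => x; rewrite /q mul1r subrK.
by rewrite L2norm_sqr dotp_addZ// mulr1 expr1n mul1r.
Unshelve. all: by end_near. Qed.

End EnergyDecay.

(** * Energy estimate for the error dynamics *)

Section Stability.
Context {R : realType}.
Local Notation mu := (@lebesgue_measure R).

(** Testing the elliptic equation with [v] gives
[gamma * ||v||^2 + ||vx||^2 = beta * <w, v>]. *)
Lemma elliptic_bound (beta gamma : R) (w v vx vxx : R -> R) :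
  0 < gamma -> L2 w -> H2 v vx vxx -> vx 0 = 0 -> vx 1 = 0 ->
  {ae mu, forall x : R, 0 <= x <= 1 -> 0 = vxx x - gamma * v x + beta * w x} ->
  L2norm v <= `|beta| / gamma * L2norm w.
Proof.
move=> gamma_gt0 Lw vH2 vx0 vx1 veq.
have [Lvxx _ _] := vH2; have [_ Lv] := H2_L2 vH2.
have := green_identity vH2; rewrite vx0 vx1 !mul0r subrr sub0r.
rewrite (@eq_dotpl _ _ (fun x => gamma * v x + (- beta) * w x))//; first last.
- have aeF := @ae_filter_ringOfSetsType _ _ _ mu.
  by apply: filterS veq => x xeq /xeq; lra.
- by apply: L2D; exact: L2Z.
rewrite dotpDl//; try exact: L2Z.
rewrite !dotpZl// => energy.
have CS := dotp_cauchy_schwarz Lw Lv.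
have gv : gamma * L2norm v ^+ 2 <= `|beta| * (L2norm w * L2norm v).
  rewrite L2norm_sqr (@le_trans _ _ (beta * dotp w v))//.
    by have := dotp_ge0 vx; lra.
  by rewrite (le_trans (ler_norm _))// normrM ler_wpM2l.
have := L2norm_ge0 v; rewrite le_eqVlt => /predU1P[<-|v0].
  by rewrite mulr_ge0 ?divr_ge0 ?L2norm_ge0// ltW.
rewrite mulrAC ler_pdivlMr// -(ler_pM2r v0).
by move: gv; lra.
Qed.

(** Of the terms of [<wt, w>], diffusion and the boundary feedback have a sign,
and Cauchy-Schwarz with [elliptic_bound] controls the coupling. *)
Lemma dissipation (rho alpha beta gamma eta2 : R)
    (w wt wx wxx v vx vxx : R -> R) :
  0 < gamma -> 0 <= eta2 -> L2 wt -> H2 w wx wxx -> wx 0 = 0 -> wx 1 = - eta2 * w 1 ->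
  {ae mu, forall x : R, 0 <= x <= 1 ->
    wt x = wxx x - rho * w x + alpha * v x - 0 * w 1} ->
  H2 v vx vxx -> vx 0 = 0 -> vx 1 = 0 ->
  {ae mu, forall x : R, 0 <= x <= 1 -> 0 = vxx x - gamma * v x + beta * w x} ->
  2 * dotp wt w <= - (2 * (rho - `|alpha| * `|beta| / gamma)) * dotp w w.
Proof.
move=> gamma_gt0 eta0 Lwt wH2 wx0 wx1 weq vH2 vx0 vx1 veq.
have [Lwxx _ _] := wH2; have [_ Lw] := H2_L2 wH2; have [_ Lv] := H2_L2 vH2.
have vw := elliptic_bound gamma_gt0 Lw vH2 vx0 vx1 veq.
have := green_identity wH2; rewrite wx0 wx1 mul0r subr0 => energy.
have coupling : alpha * dotp v w <= `|alpha| * `|beta| / gamma * dotp w w.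
  rewrite (le_trans (ler_norm _))// normrM -!mulrA ler_wpM2l//.
  rewrite (le_trans (dotp_cauchy_schwarz Lv Lw))//.
  by rewrite -L2norm_sqr expr2 !mulrA ler_wpM2r ?L2norm_ge0.
rewrite (@eq_dotpl _ _ (fun x => (wxx x + (- rho) * w x) + alpha * v x))//; first last.
- have aeF := @ae_filter_ringOfSetsType _ _ _ mu.
  by apply: filterS weq => x xeq /xeq; lra.
- by do 2?apply: L2D; try exact: L2Z.
rewrite dotpDl//; [|by apply: L2D => //; exact: L2Z|exact: L2Z].
rewrite dotpDl//; last exact: L2Z.
rewrite !dotpZl// energy.
have := dotp_ge0 wx; have : 0 <= eta2 * w 1 ^+ 2 by rewrite mulr_ge0 ?sqr_ge0.
lra.
Qed.

(** The decay rate [d] is what the damping [rho] leaves after the coupling; of the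
diffusion and the boundary feedback only the sign is used. *)
Lemma energy_stability (rho alpha beta gamma eta2 : R) :
  0 < gamma -> 0 <= eta2 -> `|alpha| * `|beta| / gamma < rho ->
  exponentially_stable rho alpha beta gamma (fun=> 0) eta2.
Proof.
move=> gamma_gt0 eta0 damped; set d := rho - `|alpha| * `|beta| / gamma.
have b0 : 0 <= `|beta| / gamma by rewrite divr_ge0// ltW.
exists (1 + `|beta| / gamma), d; split; [by rewrite lerDl|by rewrite subr_gt0|].
move=> w wt wx wxx v vx vxx sol t t0.
have Lw := state_L2 sol.
have vw : L2norm (v t) <= `|beta| / gamma * L2norm (w t).
  exact: elliptic_bound gamma_gt0 (Lw _ t0) (elliptic_H2 sol t0) (elliptic_bc0 sol t0)
    (elliptic_bc1 sol t0) (elliptic_eq sol t0).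
have decay : dotp (w t) (w t) <= expR (- (2 * d) * t) * dotp (w 0) (w 0).
  apply: (@gronwall_decay _ (fun s => dotp (w s) (w s))
    (fun s => 2 * dotp (wt s) (w s))) => //.
  - move=> s s0; apply: dotp_is_derive.
    + near=> h; apply: Lw.
      have : `|h| <= s by near: h; exact: dnbhs0_le.
      by rewrite ler_norml; lra.
    + exact/Lw/ltW.
    + exact: (deriv_L2 sol).
    + exact: (state_deriv sol).
  - move=> s s0; have s0' := ltW s0.
    exact: dissipation gamma_gt0 eta0 (deriv_L2 sol s0) (state_H2 sol s0)
      (state_bc0 sol s0) (state_bc1 sol s0) (parabolic_eq sol s0)
      (elliptic_H2 sol s0') (elliptic_bc0 sol s0') (elliptic_bc1 sol s0')
      (elliptic_eq sol s0').
  - exact: cvg_energy0 Lw (state_cvg0 sol).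
have ww : L2norm (w t) <= expR (- d * t) * L2norm (w 0).
  rewrite -(@ler_pXn2r _ 2)// ?nnegrE ?mulr_ge0 ?L2norm_ge0 ?expR_ge0//.
  rewrite exprMn !L2norm_sqr -expRM_natl.
  by rewrite [_ * (- d * t)](_ : _ = - (2 * d) * t)//; ring.
rewrite -mulrA mulrDl mul1r lerD// (le_trans vw)// ler_wpM2l//.
Unshelve. all: by end_near. Qed.

End Stability.

(** * The trace of the kernel derivative *)

Section Bessel.
Context {R : realType}.
Implicit Types (c : nat -> R) (o s x y z : R).

(** A class of coefficient sequences stable under termwise differentiation and
dominated by the exponential series, so that every function it defines is
smooth on the whole line. *)
Definition fact_bounded c := forall n, 0 <= c n <= (n`!%:R)^-1.

Lemma fact_bounded_diffs c : fact_bounded c -> fact_bounded (pseries_diffs c).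
Proof.
move=> cb n; rewrite /pseries_diffs; have /andP[c0 c1] := cb n.+1.
rewrite mulr_ge0//= (le_trans (ler_wpM2l _ c1))// factS natrM invfM mulVKf//.
Qed.

Lemma fact_bounded_cvg c s : fact_bounded c -> 0 <= s -> cvgn (pseries c s).
Proof.
move=> cb s0; apply: (@series_le_cvg _ _ (exp_coeff s)).
- by move=> n; have /andP[c0 _] := cb n; rewrite mulr_ge0// exprn_ge0.
- by move=> n; rewrite /exp_coeff/= divr_ge0// exprn_ge0.
- move=> n; have /andP[_ c1] := cb n.
  by rewrite /exp_coeff/= mulrC ler_wpM2l// exprn_ge0.
- exact: is_cvg_series_exp_coeff.
Qed.

Lemma fact_bounded_ge c s : fact_bounded c -> 0 <= s -> c 0%N <= limn (pseries c s).
Proof.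
move=> cb s0.
have := nondecreasing_cvgn_le _ (fact_bounded_cvg cb s0) 1%N.
rewrite /pseries/= seriesEnat/= big_nat1 expr0 mulr1; apply.
apply: nondecreasing_series => n _ _.
by have /andP[c0 _] := cb n; rewrite mulr_ge0// exprn_ge0.
Qed.

Lemma fact_bounded_derive c s : fact_bounded c ->
  is_derive s 1 (fun u : R => limn (pseries c u)) (limn (pseries (pseries_diffs c) s)).
Proof.
move=> cb; have K0 : 0 <= `|s| + 1 by rewrite addr_ge0.
have cb1 := fact_bounded_diffs cb; have cb2 := fact_bounded_diffs cb1.
(* Any radius larger than [`|s|] would do. *)
apply: (@pseries_snd_diffs _ c (`|s| + 1)); try exact: fact_bounded_cvg.
by rewrite [ltRHS]ger0_norm// ltrDl.
Qed.

(** The coefficients of [I_1 (sqrt s) / sqrt s], an entire function of [s]. *)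
Definition I1q_coeff (n : nat) : R := (2 * 4 ^+ n * (n`!)%:R * (n.+1`!)%:R)^-1.

Lemma I1q_coeff_bounded : fact_bounded I1q_coeff.
Proof.
move=> n; rewrite /I1q_coeff invr_ge0 ?mulr_ge0 ?exprn_ge0//=.
rewrite lef_pV2 ?posrE ?mulr_gt0 ?exprn_gt0 ?ltr0n ?fact_gt0//.
rewrite mulrAC ler_peMl ?mulr_ege1 ?exprn_ege1 ?ler1n ?fact_gt0//.
Qed.

Definition I1q s : R := limn (pseries I1q_coeff s).
Definition dI1q s : R := limn (pseries (pseries_diffs I1q_coeff) s).

(** Passing to the variable [z ^+ 2] absorbs both the singularity at 0 and the
square root in the kernel. *)
Lemma I1qE z : bessel_quotient besselI1 z = I1q (z ^+ 2).
Proof.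
rewrite /bessel_quotient; case: eqP => [->|/eqP z0].
  rewrite expr0n/= /I1q.
  apply/esym/cvg_lim => //.
  apply: cvg_near_cst; exists 1%N => // n /= n1.
  rewrite /pseries seriesEnat/= big_ltn// big1_seq ?addr0 ?expr0.
    by rewrite /I1q_coeff expr0 !mulr1.
  move=> i; rewrite mem_index_iota => /andP[_ /andP[i1 _]].
  by rewrite expr0n gtn_eqF// mulr0.
apply/(mulIf z0); rewrite divfK//.
have cI : cvgn (pseries I1q_coeff (z ^+ 2)).
  by apply: fact_bounded_cvg; [exact: I1q_coeff_bounded|exact: sqr_ge0].
rewrite /besselI1 /I1q; apply: cvg_lim => //.
have -> : series (fun m : nat => (z / 2) ^+ m.*2.+1 / ((m`!)%:R * (m.+1`!)%:R)) =
    (fun n => pseries I1q_coeff (z ^+ 2) n * z).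
  apply/funext => n; rewrite /pseries !seriesEnat/= mulr_suml.
  apply: eq_bigr => m _; rewrite /I1q_coeff.
  rewrite exprS -mul2n exprM expr_div_n (_ : 2 ^+ 2 = 4 :> R); last by ring.
  rewrite expr_div_n; field.
  by rewrite ?expf_neq0 ?pnatr_eq0 -?lt0n ?fact_gt0.
by apply: cvgM => //; exact: cvg_cst.
Qed.

Lemma kaE o x y : 0 <= o -> y ^+ 2 <= x ^+ 2 ->
  ka o x y = - o * x * I1q (o * (x ^+ 2 - y ^+ 2)).
Proof.
move=> o0 yx; rewrite /ka I1qE sqr_sqrtr// mulr_ge0// subr_ge0//.
Qed.

Definition dka o y : R :=
  - o * (I1q (o * (1 - y ^+ 2)) + 2 * o * dI1q (o * (1 - y ^+ 2))).

(** At [y = 1] and for [o > 0] the formula fails: [ka o x 1] has a corner at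
[x = 1], because the square root vanishes to the left of 1. *)
Lemma dx_at1_ka o y : 0 <= o -> 0 <= y < 1 -> dx_at1 (ka o) y = dka o y.
Proof.
move=> o0 /andP[y0 y1]; rewrite /dx_at1 derive1E.
rewrite (@near_eq_derive _ _ _ _ (fun x => - o * x * I1q (o * (x ^+ 2 - y ^+ 2)))).
  pose u (x : R) := o * (x ^+ 2 - y ^+ 2).
  have DI : is_derive (u 1) 1 I1q (dI1q (u 1)).
    exact: fact_bounded_derive I1q_coeff_bounded.
  have Du : is_derive (1 : R) 1 u (2 * o).
    by apply: is_derive_eq; rewrite /GRing.scale/=; ring.
  have Dl : is_derive (1 : R) 1 (fun x : R => - o * x) (- o).
    by apply: is_derive_eq; rewrite /GRing.scale/=; ring.
  have [_ ->] := is_deriveM Dl (is_derive1_comp DI Du).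
  by rewrite /dka /u /= expr1n /GRing.scale/=; ring.
near=> x; apply: kaE => //.
have yx : y < x by near: x; exact: lt_nbhsr.
by rewrite ler_pXn2r// ?ltW// nnegrE// ltW// (le_lt_trans y0).
Unshelve. all: by end_near. Qed.

(** All terms of both power series are nonnegative; keeping the constant ones,
1/2 for [I1q] and 1/16 for its derivative, gives the bound. *)
Lemma dka_ge o y : 0 <= o -> 0 <= y <= 1 -> o / 2 + o ^+ 2 / 8 <= - dka o y.
Proof.
move=> o0 /andP[y0 y1].
have s0 : 0 <= o * (1 - y ^+ 2) by rewrite mulr_ge0// subr_ge0 exprn_ile1.
have c0 : I1q_coeff 0 = 2^-1 by rewrite /I1q_coeff expr0 !mulr1.
have c1 : pseries_diffs I1q_coeff 0 = 16^-1.
  by rewrite /pseries_diffs /I1q_coeff !factS !fact0 !muln1; field.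
have := fact_bounded_ge I1q_coeff_bounded s0.
have := fact_bounded_ge (fact_bounded_diffs I1q_coeff_bounded) s0.
rewrite c0 c1 -/(I1q _) -/(dI1q _) /dka mulNr opprK.
move: (I1q _) (dI1q _) => a b hb ha.
have : o * (o / 16) <= o * (o * b) by rewrite !ler_wpM2l.
have : o * 2^-1 <= o * a by rewrite ler_wpM2l.
lra.
Qed.

Lemma dka_continuous o : continuous (dka o).
Proof.
have cI c : fact_bounded c -> continuous (fun s : R => limn (pseries c s)).
  move=> cb s; apply: differentiable_continuous; apply/derivable1_diffP.
  by have [] := fact_bounded_derive s cb.
have cu : continuous (fun y : R => o * (1 - y ^+ 2)).
  move=> y; apply: cvgM; first exact: cvg_cst.
  by apply: cvgB; [exact: cvg_cst|exact: exprn_continuous].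
have c1 : continuous (fun y : R => I1q (o * (1 - y ^+ 2))).
  by move=> y; apply: (continuous_comp (cu y)); exact: cI I1q_coeff_bounded _.
have c2 : continuous (fun y : R => dI1q (o * (1 - y ^+ 2))).
  move=> y; apply: (continuous_comp (cu y)).
  exact: cI (fact_bounded_diffs I1q_coeff_bounded) _.
move=> y; apply: cvgM; first exact: cvg_cst.
apply: cvgD; first exact: c1.
by apply: cvgM; [exact: cvg_cst|exact: c2].
Qed.

Lemma L2norm_dx_at1_ka o : 0 <= o ->
  (o / 2 + o ^+ 2 / 8) ^+ 2 <= L2norm (dx_at1 (ka o)) ^+ 2.
Proof.
move=> o0; rewrite L2norm_sqr.
have Ld : L2 (dka o) by apply: continuous_L2; exact: continuous_subspaceT (@dka_continuous o).
have intd := L2_integrableM Ld Ld.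
have intd' : lebesgue_measure.-integrable `[0, 1[
    (EFin \o (fun y => dka o y * dka o y)).
  by apply: integrableS intd => //; apply: subset_itv; rewrite bnd_simp.
(* Dropping the endpoint 1 from the integral makes [dx_at1_ka] available. *)
have eqd : {in `[0, 1[%classic, forall y : R,
    dka o y * dka o y = dx_at1 (ka o) y * dx_at1 (ka o) y}.
  by move=> y; rewrite inE/= in_itv/= => y01; rewrite dx_at1_ka.
have -> : dotp (dx_at1 (ka o)) (dx_at1 (ka o)) = dotp (dka o) (dka o).
  rewrite /dotp -Rintegral_itv_bndo_bndc; last first.
    by apply: eq_integrable intd' => // y /eqd /= ->.
  by rewrite -[RHS]Rintegral_itv_bndo_bndc//; apply: eq_Rintegral => y /eqd.
have L1 : L2 (fun=> o / 2 + o ^+ 2 / 8 : R).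
  by apply: continuous_L2; apply: continuous_subspaceT => x; exact: cvg_cst.
have -> : (o / 2 + o ^+ 2 / 8) ^+ 2 =
    dotp (fun=> o / 2 + o ^+ 2 / 8) (fun=> o / 2 + o ^+ 2 / 8).
  rewrite /dotp Rintegral_cst//= lebesgue_measure_itv/= lte_fin ltr01.
  by rewrite -EFinB subr0 mulr1.
apply: le_Rintegral => //; first exact: L2_integrableM.
move=> y; rewrite /= in_itv/= => y01.
by rewrite -[leRHS]mulrNN ler_pM ?dka_ge// addr_ge0 ?divr_ge0 ?exprn_ge0.
Qed.

End Bessel.

(** * Exponential stability *)

(** The difference of the two sides is a quartic with minimum about 0.03, near
[o = 1.6].  Bounding the square of [o ^+ 2 + 4 * o] from below by its tangent
at 9 leaves a positive quadratic with minimum at [o = 14 / 9]. *)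
Lemma sqr_dominates (R : realType) (o : R) :
  o <= (o / 2 + o ^+ 2 / 8) ^+ 2 / 2 + 1.
Proof.
have := sqr_ge0 (o ^+ 2 + 4 * o - 9); have := sqr_ge0 (o - 14 / 9).
lra.
Qed.

Theorem theorem18 (R : realType) (rho alpha beta gamma o2 : R)
  (alpha_neq0 : alpha != 0) (beta_neq0 : beta != 0)
  (gamma_nres : forall n : nat, gamma != - (n%:R * pi) ^+ 2)
  (gamma_gt0 : 0 < gamma)
  (o2_gt0 : 0 < o2) :
  - ka o2 1 1 = o2 / 2 /\
  (`|alpha| * `|beta| / gamma
     * (1 + triangle_norm (ka o2)) * (1 + triangle_norm (la o2))
   + ((1 + triangle_norm (la o2)) ^+ 2 * L2norm (dx_at1 (ka o2)) ^+ 2 + 2) / 2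
     < o2 + rho ->
   exponentially_stable rho alpha beta gamma (fun=> 0) (- ka o2 1 1)).
Proof.
have kaE11 : - ka o2 1 1 = o2 / 2.
  by rewrite /ka subrr mulr0 sqrtr0 /bessel_quotient eqxx mulr1 mulNr opprK.
split=> // small_gain; apply: energy_stability => //.
  by rewrite kaE11 divr_ge0// ltW.
move: small_gain.
set A := _ / gamma; have A0 : 0 <= A by rewrite divr_ge0 ?mulr_ge0// ltW.
have : 0 <= triangle_norm (la o2) by exact: sqrtr_ge0.
have : 0 <= triangle_norm (ka o2) by exact: sqrtr_ge0.
move: (triangle_norm (ka o2)) (triangle_norm (la o2)) => k l k0 l0.
have := L2norm_dx_at1_ka (ltW o2_gt0).
set K := L2norm _ ^+ 2 => hK.
(* The factors [1 + k] and [1 + l] are at least 1. *)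
have gain : A <= A * (1 + k) * (1 + l).
  by rewrite -mulrA ler_peMr// mulr_ege1// lerDl.
have lift : K <= (1 + l) ^+ 2 * K.
  by rewrite ler_peMl ?sqr_ge0// exprn_ege1// lerDl.
by have := sqr_dominates o2; lra.
Qed.
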